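(* Let $L$ be a finite language consisting of two unary relations $U$, $V$ and functions $F^1,\dots,F^n$, each of arity at least $1$. Let $\mathcal C$ be the class of all finite $L$-structures $\mathbf A$ satisfying the following: (1) $U_{\mathbf A}\cap V_{\mathbf A}=\emptyset$ and $U_{\mathbf A}\cup V_{\mathbf A}=A$, (2) for every $1\le i\le n$ it holds that $\mathrm{Dom}(F^i_{\mathbf A})\subseteq (U_{\mathbf A})^{a(F^i)}$ and $\mathrm{Range}(F^i_{\mathbf A})\subseteq V_{\mathbf A}$, where $a(F^i)$ is the arity of $F^i$. Then $\mathcal C$ has irreducible structure faithful coherent EPPA.
   Context: Structures and maps. The language has trivial permutation group. An $L$-structure $\mathbf A$ has a vertex set $A$, relations $R_{\mathbf A}\subseteq A^{a(R)}$ for relation symbols and set-valued functions $F_{\mathbf A}\colon A^{a(F)}\to\mathcal P(A)$ for function symbols. Here $\mathrm{Dom}(F_{\mathbf A})$ is the set of tuples on which $F_{\mathbf A}$ takes a nonempty value, and $\mathrm{Range}(F_{\mathbf A})\subseteq V_{\mathbf A}$ means that all values $F_{\mathbf A}(\bar x)$ are subsets of $V_{\mathbf A}$ (so the structures are two-sorted, with functions going from the first sort to the second). An embedding $f\colon\mathbf A\to\mathbf B$ is an injective map $A\to B$ with $\bar x\in R_{\mathbf A}\iff f(\bar x)\in R_{\mathbf B}$ and $f(F_{\mathbf A}(\bar x))=F_{\mathbf B}(f(\bar x))$ for all symbols $R,F$ and tuples $\bar x$; isomorphisms are bijective embeddings. $\mathbf A\subseteq\mathbf B$ is a substructure if the inclusion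 is an embedding (so substructures are closed under all functions). Irreducibility. For substructures $\mathbf B_1,\mathbf B_2$ of $\mathbf C$ with common substructure $\mathbf A$, $\mathbf C$ is the free amalgamation of $\mathbf B_1,\mathbf B_2$ over $\mathbf A$ if $C=B_1\cup B_2$, $B_1\cap B_2=A$, and whenever a tuple $\bar x$ of vertices of $\mathbf C$ contains vertices of both $B_1\setminus A$ and $B_2\setminus A$, then $\bar x$ is in no relation of $\mathbf C$ and every function of the corresponding arity has value $\emptyset$ on $\bar x$. A structure is irreducible if it is not a free amalgamation of two of its proper substructures. EPPA. A partial automorphism of $\mathbf A$ is an isomorphism between substructures of $\mathbf A$. A finite $\mathbf B$ is an EPPA-witness for $\mathbf A$ if there is an embedding $\psi\colon\mathbf A\to\mathbf B$ such that every partial automorphism of $\psi(\mathbf A)$ extends to an automorphism of $\mathbf B$. It is coherent if (for this $\psi$) the extensions $f\mapsto\hat f$ can be chosen so that $\widehat{gf}=\hat g\hat f$ whenever $\mathrm{range}(f)=\mathrm{dom}(g)$. It is irreducible structure faithful if (for this $\psi$) for every irreducible substructure $\mathbf D$ of $\mathbf B$ there is an automorphism $g$ of $\mathbf B$ with $g(D)\subseteq\psi(A)$. A class $\mathcal C$ of finite structures has irreducible structure faithful coherent EPPA if every $\mathbf A\in\mathcal C$ has an irreducible structure faithful coherent EPPA-witness $\mathbf B\in\mathcal C$. *)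

(* Defs.v *)
From HB Require Import structures.
From mathcomp Require Import all_boot.

Set Implicit Arguments.
Unset Strict Implicit.
Unset Printing Implicit Defensive.

Record language := Language {
  rel_sym : finType;
  rel_arity : rel_sym -> nat;
  fun_sym : finType;
  fun_arity : fun_sym -> nat
}.

(* Finite structures only; the vertex set may be empty. Functions are
   set-valued. *)
Record structure (L : language) := Structure {
  vertices :> finType;
  rel_of : forall R : rel_sym L, {set (rel_arity R).-tuple vertices};
  fun_of : forall F : fun_sym L,
    {ffun (fun_arity F).-tuple vertices -> {set vertices}}
}.

Definition fun_dom (L : language) (A : structure L) (F : fun_sym L) :
    {set (fun_arity F).-tuple A} :=
  [set x | fun_of A F x != set0].

Definition is_embedding (L : language) (A B : structure L) (f : A -> B) : Prop :=
  [/\ injective f,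
      forall (R : rel_sym L) (x : (rel_arity R).-tuple A),
        (x \in rel_of A R) <-> (map_tuple f x \in rel_of B R)
    & forall (F : fun_sym L) (x : (fun_arity F).-tuple A),
        f @: fun_of A F x = fun_of B F (map_tuple f x)].

Definition is_isomorphism (L : language) (A B : structure L) (f : A -> B) : Prop :=
  is_embedding f /\ bijective f.

Definition is_automorphism (L : language) (A : structure L) (f : A -> A) : Prop :=
  is_isomorphism f.

Record embedding (L : language) (A B : structure L) := Embedding {
  emb_fun :> A -> B;
  embP : is_embedding emb_fun
}.

(* A substructure is determined by its vertex set, which has to be closed under
   all functions: see [sub_val_embedding] and [substructureP] below. Closedness
   is boolean, so that a substructure carries no data besides its vertex set. *)
Definition fun_closed (L : language) (A : structure L) (D : {set A}) : bool :=
  [forall F : fun_sym L, forall x : (fun_arity F).-tuple A,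
     all (fun v => v \in D) x ==> (fun_of A F x \subset D)].

Record substructure (L : language) (A : structure L) := Substructure {
  sub_set : {set A};
  sub_closed : fun_closed sub_set
}.

Definition induced (L : language) (A : structure L) (D : {set A}) : structure L :=
  @Structure L {v : A | v \in D}
    (fun R => [set x | map_tuple val x \in rel_of A R])
    (fun F => [ffun x => [set v | val v \in fun_of A F (map_tuple val x)]]).

Definition sub_structure (L : language) (A : structure L)
    (D : substructure A) : structure L := induced (sub_set D).

Coercion sub_structure : substructure >-> structure.

Definition sub_val (L : language) (A : structure L) (D : substructure A) :
  D -> A := fun v => sval v.

Lemma sub_val_embedding (L : language) (A : structure L) (D : substructure A) :
  is_embedding (@sub_val L A D).
Proof.
split=> [|R x|F x]; first exact: val_inj.
  by rewrite inE.
apply/setP=> v; apply/imsetP/idP => [[w]|vF].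
  by rewrite ffunE inE => wF ->.
have /forallP/(_ F)/forallP/(_ (map_tuple (@sub_val L A D) x)) := sub_closed D.
have -> /= : all (fun v => v \in sub_set D) (map_tuple (@sub_val L A D) x).
  by apply/allP=> u /mapP[w _ ->]; exact: (svalP w).
move/subsetP/(_ v vF) => vD.
by exists (exist _ v vD); rewrite // ffunE inE.
Qed.

(* Conversely, any structure on a set of vertices whose inclusion is an
   embedding is the induced structure on a closed set. *)
Lemma substructureP (L : language) (A : structure L) (D : {set A})
    (r : forall R : rel_sym L, {set (rel_arity R).-tuple {v : A | v \in D}})
    (f : forall F : fun_sym L,
       {ffun (fun_arity F).-tuple {v : A | v \in D} -> {set {v : A | v \in D}}}) :
  is_embedding (fun v : Structure r f => sval v : A) ->
  [/\ fun_closed D, forall R, r R = rel_of (induced D) R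
    & forall F, f F = fun_of (induced D) F].
Proof.
case=> _ rP fP; split.
- apply/forallP=> F; apply/forallP=> x; apply/implyP=> /allP xD.
  have xD' i : tnth x i \in D by apply/xD/mem_tnth.
  pose y := [tuple (exist _ (tnth x i) (xD' i) : {v : A | v \in D}) | i < fun_arity F].
  have := fP F y; have -> : map_tuple (fun v => sval v) y = x.
    by apply: eq_from_tnth => i; rewrite tnth_map tnth_mktuple.
  by move=> <-; apply/subsetP=> v /imsetP[w _ ->]; exact: (svalP w).
- move=> R; apply/setP=> x; rewrite inE.
  by apply/idP/idP=> [/(rP R x)|xR]; last apply/(rP R x).
- move=> F; apply/ffunP=> x; rewrite ffunE; apply/setP=> v; rewrite inE.
  have /= <- := fP F x.
  by rewrite mem_imset //; exact: val_inj.
Qed.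

Lemma emb_image_closed (L : language) (A B : structure L) (f : embedding A B) :
  fun_closed (f @: [set: A]).
Proof.
apply/forallP=> F; apply/forallP=> x; apply/implyP=> /allP xf.
have xf' i : exists a, f a == tnth x i.
  by have /imsetP[a _ ->] := xf _ (mem_tnth i x); exists a.
pose y := [tuple xchoose (xf' i) | i < fun_arity F].
have -> : x = map_tuple f y.
  apply: eq_from_tnth => i; rewrite tnth_map tnth_mktuple.
  by rewrite (eqP (xchooseP (xf' i))).
by case: (embP f) => _ _ <-; apply: imsetS; apply: subsetT.
Qed.

Definition emb_image (L : language) (A B : structure L) (f : embedding A B) :
  substructure B := Substructure (emb_image_closed f).

Definition meets (T : finType) (k : nat) (x : k.-tuple T) (S : {set T}) : bool :=
  has (fun v => v \in S) x.

Definition is_free_amalgamation (L : language) (C : structure L)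
    (B1 B2 A : substructure C) : Prop :=
  let D1 := sub_set B1 :\: sub_set A in
  let D2 := sub_set B2 :\: sub_set A in
  [/\ sub_set B1 :|: sub_set B2 = [set: C],
      sub_set B1 :&: sub_set B2 = sub_set A,
      forall (R : rel_sym L) (x : (rel_arity R).-tuple C),
        meets x D1 -> meets x D2 -> x \notin rel_of C R
    & forall (F : fun_sym L) (x : (fun_arity F).-tuple C),
        meets x D1 -> meets x D2 -> fun_of C F x = set0].

Definition irreducible (L : language) (C : structure L) : Prop :=
  ~ exists B1 B2 A : substructure C,
      [/\ sub_set B1 \proper [set: C], sub_set B2 \proper [set: C]
        & is_free_amalgamation B1 B2 A].

(* [f], a map between substructures of the substructure [P] of [B], is
   extended by [g]. *)
Definition extends (L : language) (B : structure L) (P : substructure B)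
    (D E : substructure P) (g : B -> B) (f : {ffun D -> E}) : Prop :=
  forall v : D, g (sub_val (sub_val v)) = sub_val (sub_val (f v)).

(* A partial automorphism of [P] is an isomorphism [f : D -> E] between
   substructures of [P]; thus [range f = dom g] means that [f : D -> E] and
   [g : E -> G] for the same [E]. *)
Definition coherent_EPPA_via (L : language) (A B : structure L)
    (psi : embedding A B) : Prop :=
  exists hat : forall D E : substructure (emb_image psi), {ffun D -> E} -> B -> B,
    (forall (D E : substructure (emb_image psi)) (f : {ffun D -> E}),
       is_isomorphism f ->
       is_automorphism (hat D E f) /\ extends (hat D E f) f) /\
    (forall (D E G : substructure (emb_image psi))
       (f : {ffun D -> E}) (g : {ffun E -> G}),
       is_isomorphism f -> is_isomorphism g ->
       hat D G [ffun v => g (f v)] =1 hat E G g \o hat D E f).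

Definition irreducible_structure_faithful_via (L : language)
    (A B : structure L) (psi : embedding A B) : Prop :=
  forall D : substructure B, irreducible D ->
    exists2 g : B -> B, is_automorphism g
      & g @: sub_set D \subset sub_set (emb_image psi).

Definition isf_coherent_EPPA_witness (L : language) (A B : structure L) : Prop :=
  exists2 psi : embedding A B, coherent_EPPA_via psi
    & irreducible_structure_faithful_via psi.

Definition has_isf_coherent_EPPA (L : language) (C : structure L -> Prop) : Prop :=
  forall A : structure L, C A ->
    exists2 B : structure L, C B & isf_coherent_EPPA_witness A B.

(* Two unary relation symbols, [true] for U and [false] for V, and [n]
   function symbols of arities [a]. *)
Definition UV_language (n : nat) (a : 'I_n -> nat) : language :=
  @Language bool (fun _ => 1) 'I_n a.

Definition U_of (n : nat) (a : 'I_n -> nat) (A : structure (UV_language a)) :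
  {set A} := [set v | [tuple v] \in @rel_of (UV_language a) A true].

Definition V_of (n : nat) (a : 'I_n -> nat) (A : structure (UV_language a)) :
  {set A} := [set v | [tuple v] \in @rel_of (UV_language a) A false].

Definition UV_class (n : nat) (a : 'I_n -> nat)
    (A : structure (UV_language a)) : Prop :=
  [/\ U_of A :&: V_of A = set0,
      U_of A :|: V_of A = [set: A]
    & forall i : 'I_n,
        (forall x, x \in @fun_dom (UV_language a) A i ->
           forall j, tnth x j \in U_of A) /\
        (forall x, @fun_of (UV_language a) A i x \subset V_of A)].

(* Main.v *)
From HB Require Import structures.
Require Import Defs.
From mathcomp Require Import all_boot all_fingroup.

Set Implicit Arguments.
Unset Strict Implicit.
Unset Printing Implicit Defensive.

(** A structure [A] of the class is a finite set [X] (its first sort), a finite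
    set [V] (its second sort) and operations that send tuples of [X] to subsets
    of [V]. The witness keeps the second sort and enlarges only [X].

    A partial automorphism is a bijection between parts of [X] and [V]. Matching
    the complements in enumeration order extends it to permutations [p] of [X]
    and [h] of [V], functorially ([ext_comp]). Since substructures contain the
    values of the operations on their tuples, what remains of the partial
    automorphism is a triple [(S, p, h)] with [phi (p x) = h (phi x)] for all
    tuples [x] of [S] ([preserves]); no condition on the second sort is left.
    These triples form a groupoid, and a coherent EPPA-witness is a structure
    containing [A] whose automorphism group receives a functor from that
    groupoid that extends the triples ([coherent_extension]).

    Existence of such an extension: a point of the first sort is a pair
    [(x, c)], where [x] is in [X] and the valuation [c] gives a bit to every
    operation, tuple of [X], position in the tuple and vertex of [V]. A vertex
    [v] is in the value of an operation at a tuple of pairs iff the bits that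
    the entries give to their own positions have odd sum. A permutation [p] of
    [X] can then be corrected to an automorphism: wherever [p] fails to preserve
    the operation, flip an even number of bits. On tuples of [S] it does not
    fail, and every other tuple has a first entry outside [S], which absorbs the
    second flip ([valued_extension]).

    Faithfulness: in an irreducible substructure any two points of the first
    sort occur in a common tuple with a nonempty value
    ([irreducible_linked]). Call a set [D] of points bad if no automorphism
    moves it into the image of [X]. In a second extension, each point gets a
    colour for every bad [D] that contains it, out of a palette with one colour
    less than [D] has elements, and a tuple has empty value unless its entries
    have distinct colours for every [D]. By the pigeonhole principle a set of
    pairwise linked points never projects onto a bad set
    ([compatible_not_bad]), while a good set can be recoloured by an
    automorphism to lie in the image of [X] ([compatible_faithful]). A bad set
    is never contained in the image of [X], so its points in that image can be
    coloured injectively, and partial bijections of palettes again extend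
    coherently
    ([coloured_extension]). *)

(** * Tuples *)

Lemma map_tuple_comp (T1 T2 T3 : Type) m (f : T2 -> T3) (g : T1 -> T2)
    (x : m.-tuple T1) : map_tuple f (map_tuple g x) = map_tuple (f \o g) x.
Proof. by apply: val_inj => /=; rewrite map_comp. Qed.

Lemma eq_map_tuple (T1 T2 : Type) m (f g : T1 -> T2) (x : m.-tuple T1) :
  f =1 g -> map_tuple f x = map_tuple g x.
Proof. by move=> fg; apply: val_inj => /=; apply: eq_map. Qed.

Lemma map_tuple_id (T : Type) m (f : T -> T) (x : m.-tuple T) :
  f =1 id -> map_tuple f x = x.
Proof. by move=> fi; apply: val_inj => /=; rewrite -[RHS]map_id; apply: eq_map. Qed.

Lemma tuple1_eta (T : Type) (t : 1.-tuple T) : t = [tuple thead t].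
Proof. by case/tupleP: t => w t; rewrite theadE (tuple0 t); apply: val_inj. Qed.

(** * Coherent extension of partial bijections *)

HB.lock Definition to_perm (T : finType) (f : T -> T) : {perm T} :=
  odflt 1%g [pick s : {perm T} | [forall x, s x == f x]].

Section Extension.
Variable T : finType.
Implicit Types (Q R S : {set T}) (f g k : T -> T).

Definition extendable Q R S f :=
  [/\ S \subset Q, f @: S \subset R, {in S &, injective f} & #|Q| = #|R|].

Definition ext Q R S f x :=
  if x \in S then f x
  else nth x (enum (R :\: f @: S)) (index x (enum (Q :\: S))).

Lemma ext_in Q R S f x : x \in S -> ext Q R S f x = f x.
Proof. by rewrite /ext => ->. Qed.

Lemma size_ext_compl Q R S f : extendable Q R S f ->
  size (enum (R :\: f @: S)) = size (enum (Q :\: S)).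
Proof.
case=> SQ fSR f_inj cQR.
rewrite -!cardE !cardsD (setIidPr SQ) (setIidPr fSR) cQR.
by rewrite (card_in_imset f_inj).
Qed.

Lemma ext_out Q R S f x : extendable Q R S f -> x \in Q -> x \notin S ->
  ext Q R S f x \in R :\: f @: S.
Proof.
move=> ex xQ xS; rewrite /ext (negbTE xS) -mem_enum mem_nth //.
by rewrite (size_ext_compl ex) index_mem mem_enum inE xS.
Qed.

Lemma ext_mem Q R S f x : extendable Q R S f -> x \in Q -> ext Q R S f x \in R.
Proof.
move=> ex xQ; have [xS|xS] := boolP (x \in S).
  by case: ex => _ fSR _ _; rewrite ext_in // (subsetP fSR) // imset_f.
by have := ext_out ex xQ xS; rewrite inE => /andP[].
Qed.

Lemma ext_inj Q R S f : extendable Q R S f -> {in Q &, injective (ext Q R S f)}.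
Proof.
move=> ex x y xQ yQ.
have [xS|xS] := boolP (x \in S); have [yS|yS] := boolP (y \in S).
- by case: ex => _ _ f_inj _; rewrite !ext_in //; exact: f_inj.
- have := ext_out ex yQ yS; rewrite inE => /andP[/negP yf _] e.
  by case: yf; rewrite -e ext_in // imset_f.
- have := ext_out ex xQ xS; rewrite inE => /andP[/negP xf _] e.
  by case: xf; rewrite e ext_in // imset_f.
have mx : x \in enum (Q :\: S) by rewrite mem_enum inE xS.
have my : y \in enum (Q :\: S) by rewrite mem_enum inE yS.
rewrite /ext (negbTE xS) (negbTE yS) (set_nth_default y x); last first.
  by rewrite (size_ext_compl ex) index_mem.
move/eqP; rewrite nth_uniq ?(size_ext_compl ex) ?index_mem ?enum_uniq // => /eqP e.
by rewrite -(nth_index x mx) e nth_index.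
Qed.

(** Matching the complements in enumeration order makes the extension
    functorial: an element outside [S] keeps its rank in all the complements
    that it is sent through. *)
Lemma ext_comp Q R R' S f g k :
  extendable Q R S f -> extendable R R' (f @: S) g ->
  {in S, forall x, k x = g (f x)} ->
  {in Q, forall x, ext R R' (f @: S) g (ext Q R S f x) = ext Q R' S k x}.
Proof.
move=> exf exg kgf x xQ; have [xS|xS] := boolP (x \in S).
  by rewrite !ext_in // ?kgf // imset_f.
have := ext_out exf xQ xS; rewrite inE => /andP[yf yR].
have kS : k @: S = g @: (f @: S).
  by rewrite -imset_comp; apply: eq_in_imset => z zS /=; rewrite kgf.
have xi : index x (enum (Q :\: S)) < size (enum (R :\: f @: S)).
  by rewrite (size_ext_compl exf) index_mem mem_enum inE xS.
rewrite {1}/ext (negbTE yf) /ext (negbTE xS) kS index_uniq ?enum_uniq //.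
by apply: set_nth_default; rewrite (size_ext_compl exg).
Qed.

Lemma to_permE f : injective f -> to_perm f =1 f.
Proof.
move=> f_inj; rewrite to_perm.unlock; case: pickP => [s /forallP sf x|/(_ (perm f_inj))].
  exact/eqP.
by move/negP; case; apply/forallP=> x; rewrite permE.
Qed.

Definition ext_perm S f := to_perm (ext setT setT S f).

Lemma extendableT S f : {in S &, injective f} -> extendable setT setT S f.
Proof. by split; rewrite ?subsetT. Qed.

Lemma ext_permE S f : {in S &, injective f} -> ext_perm S f =1 ext setT setT S f.
Proof.
move=> f_inj; apply: to_permE => x y.
by apply: (ext_inj (extendableT f_inj)); rewrite inE.
Qed.

Lemma ext_perm_in S f x : {in S &, injective f} -> x \in S -> ext_perm S f x = f x.
Proof. by move=> f_inj xS; rewrite ext_permE // ext_in. Qed.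

Lemma ext_perm_comp S f g k :
  {in S &, injective f} -> {in f @: S &, injective g} ->
  {in S, forall x, k x = g (f x)} ->
  (ext_perm S f * ext_perm (f @: S) g)%g = ext_perm S k.
Proof.
move=> f_inj g_inj kgf; apply/permP=> x; rewrite permM !ext_permE //.
  by apply: ext_comp => //; apply: extendableT.
move=> y z yS zS; rewrite !kgf // => e; apply: (f_inj _ _ yS zS).
by apply: g_inj e; apply: imset_f.
Qed.

End Extension.

(** * Set-valued operations and their partial automorphisms *)

Section Operations.
Variables (n : nat) (a : 'I_n -> nat) (V : finType).

Definition operations (T : finType) := forall i : 'I_n, (a i).-tuple T -> {set V}.

Definition preserves (T : finType) (phi : operations T) (S : {set T})
    (g : {perm T}) (h : {perm V}) : bool :=
  [forall i, forall x : (a i).-tuple T, all (mem S) x ==>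
     (phi i (map_tuple g x) == h @: phi i x)].

Lemma preservesP (T : finType) (phi : operations T) (S : {set T})
    (g : {perm T}) (h : {perm V}) :
  reflect (forall i (x : (a i).-tuple T), all (mem S) x ->
             phi i (map_tuple g x) = h @: phi i x)
          (preserves phi S g h).
Proof.
apply: (iffP forallP) => H i; last first.
  by apply/forallP=> x; apply/implyP=> /H ->.
by move=> x xS; have /forallP/(_ x)/implyP/(_ xS)/eqP := H i.
Qed.

Lemma preserves_sub (T : finType) (phi : operations T) (S S' : {set T}) g h :
  S \subset S' -> preserves phi S' g h -> preserves phi S g h.
Proof.
move=> /subsetP SS' /preservesP gP; apply/preservesP=> i x /allP xS.
by apply: gP; apply/allP=> y /xS /SS'.
Qed.

Lemma preservesM (T : finType) (phi : operations T) (S : {set T}) g h g' h' :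
  preserves phi S g h -> preserves phi (g @: S) g' h' ->
  preserves phi S (g * g')%g (h * h')%g.
Proof.
move=> /preservesP gP /preservesP gP'; apply/preservesP=> i x xS.
have gxS : all (mem (g @: S)) (map_tuple g x).
  by apply/allP=> _ /mapP[y /(allP xS) yS ->]; apply: imset_f.
rewrite (eq_imset (g := h' \o h)) => [|v]; last by rewrite permM.
rewrite imset_comp -gP // -gP' // map_tuple_comp.
by congr (phi _ _); apply: eq_map_tuple => z; rewrite permM.
Qed.

(** Coherence in terms of groups: the triples [(S, p, h)] are the morphisms of
    a groupoid, [(S, p, h)] going from [S] to [p @: S], and [hat] is a functor
    from it to the group of automorphisms of [Phi]. The permutation of [V] is
    not changed. *)
Definition coherent_extension (X Y : finType) (phi : operations X)
    (Phi : operations Y) (psi : X -> Y)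
    (hat : {set X} -> {perm X} -> {perm V} -> {perm Y}) : Prop :=
  [/\ injective psi,
      forall i x, Phi i (map_tuple psi x) = phi i x,
      forall S p h, preserves phi S p h ->
        preserves Phi setT (hat S p h) h /\
        {in S, forall x, hat S p h (psi x) = psi (p x)}
    & forall S p h q k, preserves phi S p h -> preserves phi (p @: S) q k ->
        hat S (p * q)%g (h * k)%g = (hat S p h * hat (p @: S) q k)%g].

Definition linked (Z : finType) (Phi : operations Z) (C : {set Z}) : Prop :=
  {in C &, forall z w, z != w ->
     exists i, exists2 x : (a i).-tuple Z, z \in x /\ w \in x & Phi i x != set0}.

End Operations.

(** * Valuations: extending the partial automorphisms *)

Section Valuations.
Variables (n : nat) (a : 'I_n -> nat) (ha : forall i, 0 < a i).
Variables (V X : finType) (phi : operations a V X).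
Implicit Types (S : {set X}) (p q : {perm X}) (h k : {perm V}).
Local Open Scope group_scope.
Arguments phi : clear implicits.

Definition slot := {i : 'I_n & ((a i).-tuple X * 'I_(a i) * V)%type}.

Definition mk_slot i (x : (a i).-tuple X) (j : 'I_(a i)) (v : V) : slot :=
  Tagged (fun i => ((a i).-tuple X * 'I_(a i) * V)%type) (x, j, v).

Definition valued := (X * {ffun slot -> bool})%type.

Definition valued_ops : operations a V valued := fun i y =>
  [set v | \big[addb/false]_(j < a i)
     (tnth y j).2 (mk_slot (map_tuple fst y) j v)].

Definition base_valuation : {ffun slot -> bool} :=
  [ffun s => let: existT i (x, j, v) := s in (val j == 0) && (v \in phi i x)].

(** One valuation for all elements of [X]: lifting [p] then moves
    [valued_base x] to [valued_base (p x)] as soon as it corrects the defect at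
    the first positions, for all slots by the same rule. *)
Definition valued_base (x : X) : valued := (x, base_valuation).

Lemma xor_first i (b : bool) :
  \big[addb/false]_(j < a i) ((val j == 0) && b) = b.
Proof.
rewrite (bigD1 (Ordinal (ha i))) //= big1 ?addbF // => j.
by rewrite -val_eqE /= => /negbTE ->.
Qed.

Lemma valued_base_inj : injective valued_base.
Proof. by move=> x y []. Qed.

Lemma valued_ops_base i x : valued_ops (map_tuple valued_base x) = phi i x.
Proof.
apply/setP=> v; rewrite inE -[RHS](xor_first i); apply: eq_bigr => j _.
rewrite tnth_map ffunE /=; congr (_ && (v \in phi _ _)).
by apply: eq_from_tnth => l; rewrite !tnth_map.
Qed.

Definition act p h (s : slot) : slot :=
  let: existT i (x, j, v) := s in mk_slot (map_tuple p x) j (h v).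

Definition outside S (x : seq X) := find (fun y => y \notin S) x.

Definition defect p h (s : slot) : bool :=
  let: existT i (x, j, v) := s in (h v \in phi i (map_tuple p x)) (+) (v \in phi i x).

(** The positions at which the defect is flipped: the first one, to which
    [base_valuation] assigns the value, and the first one with an entry
    outside [S]. If these coincide, the two flips cancel. An element of [S] only
    undergoes the first kind of flip, which is why the lift of [p] takes
    [valued_base x] to [valued_base (p x)] for [x] in [S]. *)
Definition charge S (y : X) (s : slot) : bool :=
  let: existT i (x, j, v) := s in
  (val j == 0) (+) ((y \notin S) && (val j == outside S x)).

Definition flip S p h y s := charge S y s && defect p h s.

Definition valued_lift S p h (y : valued) : valued :=
  (p y.1, [ffun s => let s' := act p^-1 h^-1 s in y.2 s' (+) flip S p h y.1 s']).

Lemma actM p q h k s : act (p * q) (h * k) s = act q k (act p h s).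
Proof.
case: s => i [[x j] v] /=; rewrite map_tuple_comp permM.
by congr (mk_slot _ j _); apply: eq_map_tuple => y; rewrite permM.
Qed.

Lemma act1 s : act 1 1 s = s.
Proof.
case: s => i [[x j] v] /=; rewrite perm1 map_tuple_id // => y.
by rewrite perm1.
Qed.

Lemma actK p h : cancel (act p h) (act p^-1 h^-1).
Proof. by move=> s; rewrite -actM !mulgV act1. Qed.

Lemma actKV p h : cancel (act p^-1 h^-1) (act p h).
Proof. by move=> s; rewrite -actM !mulVg act1. Qed.

Lemma valued_lift2E S p h y s :
  (valued_lift S p h y).2 (act p h s) = y.2 s (+) flip S p h y.1 s.
Proof. by rewrite ffunE /= actK. Qed.

Lemma eq_act p h (c d : {ffun slot -> bool}) :
  (forall s, c (act p h s) = d (act p h s)) -> c = d.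
Proof. by move=> cd; apply/ffunP=> s; rewrite -(actKV p h s). Qed.

Lemma valued_lift_inj S p h : injective (valued_lift S p h).
Proof.
move=> [x c] [y d] e; have xy : x = y by move: e => /(congr1 fst) /perm_inj.
rewrite -xy in e *; congr (_, _); apply/ffunP=> s.
apply: (can_inj (addbK (flip S p h x s))).
by rewrite -[LHS](valued_lift2E S p h (x, c)) e valued_lift2E.
Qed.

Definition valued_hat S p h : {perm valued} := perm (@valued_lift_inj S p h).

(** On tuples of [S] the second flip is missing; [defect] vanishes there. *)
Lemma xor_charge S i (x : (a i).-tuple X) v :
  \big[addb/false]_(j < a i) charge S (tnth x j) (mk_slot x j v) = all (mem S) x.
Proof.
have -> : all (mem S) x = ~~ has (fun y => y \notin S) x.
  by rewrite -all_predC; apply: eq_all => y /=; rewrite negbK.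
under eq_bigr => j _.
  rewrite /= (_ : (_ && _) = (val j == outside S x)); first over.
  case: eqP => [e|]; rewrite ?andbF ?andbT //.
  rewrite (tnth_nth (tnth x j)) e.
  apply: (@nth_find _ _ (fun y => y \notin S)); rewrite has_find size_tuple.
  by rewrite -/(outside S x) -e.
rewrite big_split /=.
have -> : \big[addb/false]_(j < a i) (val j == 0) = true.
  by rewrite -[RHS](xor_first i); under [RHS]eq_bigr do rewrite andbT.
(* [outside S x] is a position of [x] unless all entries are in [S]. *)
rewrite addTb has_find size_tuple -/(outside S x); congr (~~ _).
have [lt|ge] := ltnP (outside S x) (a i).
  by rewrite (bigD1 (Ordinal lt)) //= eqxx big1 // => j; rewrite -val_eqE /= => /negbTE.
by rewrite big1 // => j _; apply/eqP=> e; move: (ltn_ord j); rewrite e ltnNge ge.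
Qed.

Lemma defect_preserved S p h i (x : (a i).-tuple X) j v :
  preserves phi S p h -> all (mem S) x -> defect p h (mk_slot x j v) = false.
Proof.
move=> /preservesP pS xS; rewrite /= pS // mem_imset ?addbb //; exact: perm_inj.
Qed.

Lemma valued_hat_preserves S p h :
  preserves phi S p h -> preserves valued_ops setT (valued_hat S p h) h.
Proof.
move=> pS; apply/preservesP=> i y _; apply/setP=> w.
rewrite -(permKV h w); move: (h^-1%g w) => v.
rewrite (mem_imset _ _ (@perm_inj _ h)) !inE.
set x := map_tuple fst y.
have xh : map_tuple fst (map_tuple (valued_hat S p h) y) = map_tuple p x.
  by rewrite !map_tuple_comp; apply: eq_map_tuple => z; rewrite /= permE.
transitivity (\big[addb/false]_(j < a i)
   ((tnth y j).2 (mk_slot x j v) (+) flip S p h (tnth x j) (mk_slot x j v))).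
  apply: eq_bigr => j _; rewrite xh tnth_map permE.
  by rewrite -[mk_slot _ _ (h v)]/(act p h (mk_slot x j v)) valued_lift2E tnth_map.
(* The flips at the slots of this tuple and [v] have even sum. *)
rewrite big_split /= [X in _ (+) X](_ : _ = false) ?addbF //.
have E j : defect p h (mk_slot x j v) = defect p h (mk_slot x (Ordinal (ha i)) v) by [].
under eq_bigr => j _ do rewrite /flip E.
rewrite -big_distrl /= (xor_charge S x v); case: (boolP (all (mem S) x)) => [xS|//].
exact: (defect_preserved (Ordinal (ha i)) v pS xS).
Qed.

Lemma valued_hat_base S p h :
  {in S, forall x, valued_hat S p h (valued_base x) = valued_base (p x)}.
Proof.
move=> x xS; rewrite permE /valued_lift /valued_base /=; congr (_, _).
apply: (@eq_act p h) => s; rewrite ffunE /= actK.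
case: s => i [[y j] v]; rewrite /base_valuation /flip !ffunE /= xS /= addbF.
by case: (val j == 0); case: (v \in _); case: (h v \in _).
Qed.

Lemma outside_map S p (x : seq X) : outside (p @: S) (map p x) = outside S x.
Proof.
by rewrite /outside find_map; apply: eq_find => y /=; rewrite mem_imset //; exact: perm_inj.
Qed.

(** The defect is a cocycle, and the first entry outside [S] moves along with
    the tuple. *)
Lemma valued_hatM S p h q k :
  valued_hat S (p * q)%g (h * k)%g = (valued_hat S p h * valued_hat (p @: S) q k)%g.
Proof.
apply/permP=> y; rewrite permM !permE; move: y => [y c].
rewrite /valued_lift /= permM; congr (_, _); apply: (@eq_act (p * q) (h * k)) => s.
rewrite [LHS]ffunE [RHS]ffunE ffunE /= actK actM !actK -addbA; congr (_ (+) _).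
case: s => i [[x j] v]; rewrite /flip /= outside_map mem_imset; last exact: perm_inj.
rewrite -andb_addr permM addbC.
have -> : map_tuple (p * q)%g x = map_tuple q (map_tuple p x).
  by rewrite map_tuple_comp; apply: eq_map_tuple => z; rewrite permM.
congr (_ && _).
by case: (_ \in _); case: (_ \in _); case: (_ \in _).
Qed.

Lemma valued_extension :
  coherent_extension phi valued_ops valued_base valued_hat.
Proof.
split=> [|i x|S p h pS|S p h q k _ _].
- exact: valued_base_inj.
- exact: valued_ops_base.
- by split; [exact: valued_hat_preserves|exact: valued_hat_base].
- exact: valued_hatM.
Qed.

End Valuations.

(** * Colourings: making linked sets good *)

Section Colours.
Variables (n : nat) (a : 'I_n -> nat) (V X Y : finType).
Variables (phi : operations a V X) (Phi : operations a V Y) (psi : X -> Y).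
Variable hat : {set X} -> {perm X} -> {perm V} -> {perm Y}.
Hypothesis hat_ext : coherent_extension phi Phi psi hat.
Implicit Types (D : {set Y}) (g : {perm Y}) (h k : {perm V}) (p q : {perm X}).
Implicit Types (S : {set X}).
Arguments phi : clear implicits.
Arguments Phi : clear implicits.
Local Open Scope group_scope.

Definition bad D : bool :=
  [forall g : {perm Y}, forall h : {perm V},
     preserves Phi setT g h ==> ~~ (g @: D \subset codom psi)].

Lemma badPn D :
  reflect (exists g h, preserves Phi setT g h /\ g @: D \subset codom psi)
          (~~ bad D).
Proof.
apply: (iffP idP) => [/forallPn[g /forallPn[h]]|[g [h [gP gD]]]].
  by rewrite negb_imply negbK => /andP[? ?]; exists g, h.
by apply/forallPn; exists g; apply/forallPn; exists h; rewrite gP gD.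
Qed.

Lemma preserves1 : preserves Phi setT 1 1.
Proof.
apply/preservesP=> i x _; rewrite map_tuple_id => [|y]; last by rewrite perm1.
by rewrite -[LHS]imset_id; apply: eq_imset => v; rewrite perm1.
Qed.

Lemma preservesV g h : preserves Phi setT g h -> preserves Phi setT g^-1 h^-1.
Proof.
move=> /preservesP gP; apply/preservesP=> i x _.
have T m (y : m.-tuple Y) : all (mem [set: Y]) y by apply/allP=> z; rewrite inE.
rewrite -{2}(map_tuple_id (f := g \o g^-1) x) => [|y]; last by rewrite /= permKV.
by rewrite -map_tuple_comp gP // -imset_comp -[LHS]imset_id;
  apply: eq_imset => v; rewrite /= permK.
Qed.

Lemma automorphismM g h g' h' : preserves Phi setT g h -> preserves Phi setT g' h' ->
  preserves Phi setT (g * g') (h * h').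
Proof. by move=> gP gP'; apply: preservesM gP (preserves_sub (subsetT _) gP'). Qed.

Lemma bad_image g h D : preserves Phi setT g h -> bad (g @: D) = bad D.
Proof.
move=> gP; apply: negb_inj.
apply/badPn/badPn => [[g' [h' [gP' s]]]|[g' [h' [gP' s]]]].
  exists (g * g'), (h * h'); split; first exact: automorphismM.
  rewrite (eq_imset (g := g' \o g)) => [|v]; last by rewrite permM.
  by rewrite imset_comp.
exists (g^-1 * g'), (h^-1 * h'); split; first exact/automorphismM/gP'/preservesV.
rewrite -imset_comp (eq_imset (g := g')) // => v.
by rewrite /= permM permK.
Qed.

(** The colours for [D] are the elements of [D] except one outside the image of
    [psi], which exists if [D] is bad. So [psi x] can serve as its own
    colour. *)
Definition palette D : {set Y} :=
  if [pick d in D | d \notin codom psi] is Some d then D :\ d else D.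

Lemma palette_base D x : psi x \in D -> psi x \in palette D.
Proof.
rewrite /palette; case: pickP => // d /andP[_ dX] xD.
by rewrite !inE xD andbT; apply: contraNneq dX => <-; exact: codom_f.
Qed.

Lemma card_palette D : bad D -> #|D| = #|palette D|.+1.
Proof.
move=> /forallP/(_ 1)/forallP/(_ 1); rewrite preserves1 /=.
rewrite (eq_imset (g := id)) => [|v]; last by rewrite perm1.
rewrite imset_id => nD; rewrite /palette; case: pickP => [d /andP[dD _]|no].
  by rewrite (cardsD1 d D) dD.
by case/negP: nD; apply/subsetP=> d dD; have /negbT := no d; rewrite dD negbK.
Qed.

(** Where no colour is needed, the value is fixed to the base point; free
    values would make points that no automorphism takes to the image of
    [X]. *)
Definition valid_colouring (z : Y * {ffun {set Y} -> Y}) : bool :=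
  [forall D : {set Y}, if bad D && (z.1 \in D) then z.2 D \in palette D
                       else z.2 D == z.1].

Definition coloured := {z : Y * {ffun {set Y} -> Y} | valid_colouring z}.

Definition base_of (z : coloured) : Y := (val z).1.
Definition colour (z : coloured) (D : {set Y}) : Y := (val z).2 D.

Lemma colourP (z : coloured) D :
  if bad D && (base_of z \in D) then colour z D \in palette D
  else colour z D == base_of z.
Proof. by move: (svalP z) => /forallP/(_ D). Qed.

Definition compatible (z w : coloured) : bool :=
  (base_of z != base_of w) &&
  [forall D : {set Y}, [&& bad D, base_of z \in D & base_of w \in D] ==>
     (colour z D != colour w D)].

Definition generic (s : seq coloured) : bool :=
  all (fun z => all (fun w => (z == w) || compatible z w) s) s.

Definition coloured_ops : operations a V coloured := fun i z =>
  if generic z then Phi i (map_tuple base_of z) else set0.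

Lemma coloured_eq (z w : coloured) :
  base_of z = base_of w -> colour z =1 colour w -> z = w.
Proof.
move=> b c; apply: val_inj; move: b c; rewrite /base_of /colour.
by case: (val z) (val w) => [y f] [y' f'] /= -> /ffunP ->.
Qed.

Lemma valid_base x : valid_colouring (psi x, [ffun=> psi x]).
Proof.
apply/forallP=> D; rewrite /= ffunE; case: ifP => // /andP[_].
exact: palette_base.
Qed.

Definition coloured_base (x : X) : coloured := Sub _ (valid_base x).

Lemma colour_base x D : colour (coloured_base x) D = psi x.
Proof. by rewrite /colour /= ffunE. Qed.

Lemma coloured_base_inj : injective coloured_base.
Proof.
by case: hat_ext => psi_inj _ _ _ x y /(congr1 base_of); exact: psi_inj.
Qed.

Lemma coloured_ops_base i x : coloured_ops (map_tuple coloured_base x) = phi i x.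
Proof.
case: hat_ext => psi_inj <- _ _; rewrite /coloured_ops ifT.
  by rewrite map_tuple_comp.
apply/allP=> _ /mapP[y _ ->]; apply/allP=> _ /mapP[z _ ->].
have [<-|yz] := eqVneq y z; first by rewrite eqxx.
have psi_yz : psi y != psi z by rewrite (inj_eq psi_inj).
rewrite /compatible psi_yz; apply/orP; right; apply/forallP=> D.
by rewrite !colour_base psi_yz implybT.
Qed.

(** An automorphism of [Phi] lifts once it is combined with bijections from the
    palette of each bad [D] to that of its image. *)
Section Lift.
Variables (g : {perm Y}) (h : {perm V}) (recolour : {set Y} -> Y -> Y).

Definition lifts := preserves Phi setT g h /\ forall D, bad D ->
  {in palette D, forall c, recolour D c \in palette (g @: D)} /\
  {in palette D &, injective (recolour D)}.

Definition raw_lift (z : coloured) : Y * {ffun {set Y} -> Y} :=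
  (g (base_of z), [ffun D : {set Y} => let D' := g^-1 @: D in
     if bad D' && (base_of z \in D') then recolour D' (colour z D')
     else g (base_of z)]).

Definition coloured_lift (z : coloured) : coloured := insubd z (raw_lift z).

Hypothesis gP : lifts.

Lemma perm_imsetK D : g^-1 @: (g @: D) = D.
Proof.
rewrite -imset_comp (eq_imset (g := id)) ?imset_id // => v.
by rewrite /= permK.
Qed.

Lemma perm_imsetVK D : g @: (g^-1 @: D) = D.
Proof.
rewrite -imset_comp (eq_imset (g := id)) ?imset_id // => v.
by rewrite /= permKV.
Qed.

Lemma val_coloured_lift z : val (coloured_lift z) = raw_lift z.
Proof.
apply: insubdK; apply/forallP=> D; rewrite /= ffunE.
rewrite -(perm_imsetVK D); move: (g^-1 @: D) => {}D; rewrite perm_imsetK.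
case: gP => aut rP; rewrite (bad_image _ aut) mem_imset; last exact: perm_inj.
have := colourP z D; case: ifP => [/andP[bD _] cz|_ _]; last exact: eqxx.
by case: (rP D bD) => r _; exact: r.
Qed.

Lemma base_lift z : base_of (coloured_lift z) = g (base_of z).
Proof. by rewrite {1}/base_of val_coloured_lift. Qed.

Lemma colour_lift z D : colour (coloured_lift z) (g @: D) =
  if bad D && (base_of z \in D) then recolour D (colour z D) else g (base_of z).
Proof. by rewrite {1}/colour val_coloured_lift ffunE /= perm_imsetK. Qed.

Lemma coloured_lift_inj : injective coloured_lift.
Proof.
move=> z w e; have b : base_of z = base_of w.
  by apply: (@perm_inj _ g); rewrite -!base_lift e.
apply: coloured_eq => // D.
have := colour_lift z D; rewrite e colour_lift -b.
have := colourP z D; have := colourP w D; rewrite -b.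
case: ifP => [bD cw cz|_ /eqP-> /eqP-> //].
by case: gP => _ /(_ D (andP bD).1)[_ r] /esym; exact: r.
Qed.

Lemma compatible_lift z w :
  compatible (coloured_lift z) (coloured_lift w) = compatible z w.
Proof.
rewrite /compatible !base_lift (inj_eq perm_inj); congr (_ && _).
case: gP => aut rP.
apply/forallP/forallP => H D.
  have := H (g @: D); rewrite (bad_image _ aut) !mem_imset; try exact: perm_inj.
  move/implyP=> {}H; apply/implyP=> /and3P[bD zD wD].
  have := H; rewrite bD zD wD => /(_ isT); rewrite !colour_lift bD zD wD /=.
  by apply: contraNneq => ->.
rewrite -(perm_imsetVK D); move: (g^-1 @: D) => {}D.
rewrite (bad_image _ aut) !mem_imset; try exact: perm_inj.
apply/implyP=> /and3P[bD zD wD]; rewrite !colour_lift bD zD wD /=.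
have := H D; rewrite bD zD wD /=; apply: contraNneq => e; apply/eqP.
have := colourP z D; have := colourP w D; rewrite bD zD wD /= => cw cz.
by case: (rP D bD) => _; apply.
Qed.

Lemma generic_lift (s : seq coloured) : generic (map coloured_lift s) = generic s.
Proof.
rewrite /generic all_map; apply: eq_all => z /=; rewrite all_map; apply: eq_all => w /=.
by rewrite (inj_eq coloured_lift_inj) compatible_lift.
Qed.

Lemma coloured_lift_preserves :
  preserves coloured_ops setT (to_perm coloured_lift) h.
Proof.
apply/preservesP=> i z _.
have -> : map_tuple (to_perm coloured_lift) z = map_tuple coloured_lift z.
  by apply: eq_map_tuple => w; rewrite to_permE //; exact: coloured_lift_inj.
rewrite /coloured_ops generic_lift; case: ifP => _; last by rewrite imset0.
case: gP => /preservesP aut _.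
rewrite -aut; last by apply/allP=> y; rewrite inE.
by rewrite !map_tuple_comp; congr (Phi _ _); apply: eq_map_tuple => w; rewrite /= base_lift.
Qed.

End Lift.

(** The colours [psi x] with [x] in [S] have to follow the points that they
    colour; the other colours are matched coherently. *)
Definition recolour S g D : Y -> Y :=
  ext (palette D) (palette (g @: D)) (psi @: S :&: D) g.

Definition coloured_hat S p h : {perm coloured} :=
  let g := hat S p h in to_perm (coloured_lift g (recolour S g)).

Lemma recolour_extendable S p h D : preserves phi S p h -> bad D ->
  let g := hat S p h in
  extendable (palette D) (palette (g @: D)) (psi @: S :&: D) g.
Proof.
move=> pS bD /=; case: hat_ext => _ _ /(_ S p h pS)[gP ge] _; split.
- apply/subsetP=> y; rewrite inE => /andP[/imsetP[x _ ->]]; exact: palette_base.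
- apply/subsetP=> _ /imsetP[y + ->]; rewrite inE => /andP[/imsetP[x xS ->] xD].
  by rewrite ge //; apply: palette_base; rewrite -ge // imset_f.
- by move=> x y _ _; exact: perm_inj.
- apply: succn_inj; rewrite -!card_palette // ?(bad_image _ gP) //.
  by rewrite card_imset //; exact: perm_inj.
Qed.

Lemma recolour_lifts S p h : preserves phi S p h ->
  lifts (hat S p h) h (recolour S (hat S p h)).
Proof.
move=> pS; split; first by case: hat_ext => _ _ /(_ S p h pS)[].
move=> D bD; have ex := recolour_extendable pS bD.
by split=> [c|]; [exact: ext_mem|exact: ext_inj].
Qed.

Lemma coloured_hatE S p h : preserves phi S p h ->
  coloured_hat S p h =1 coloured_lift (hat S p h) (recolour S (hat S p h)).
Proof.
by move=> pS; apply: to_permE; apply: coloured_lift_inj; exact: recolour_lifts pS.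
Qed.

Lemma coloured_hat_base S p h : preserves phi S p h ->
  {in S, forall x, coloured_hat S p h (coloured_base x) = coloured_base (p x)}.
Proof.
move=> pS x xS; have gl := recolour_lifts pS.
case: hat_ext => _ _ /(_ S p h pS)[gP ge] _.
rewrite coloured_hatE //; apply: coloured_eq => [|D].
  by rewrite (base_lift gl) /base_of /= ge.
rewrite -(perm_imsetVK (hat S p h) D); move: (_ @: D) => {}D.
rewrite (colour_lift gl) !colour_base; case: ifP => [/andP[_ xD]|_].
  by rewrite /recolour ext_in ?ge // inE xD imset_f.
by rewrite /base_of /= ge.
Qed.

Lemma coloured_hatM S p h q k : preserves phi S p h -> preserves phi (p @: S) q k ->
  coloured_hat S (p * q) (h * k) = coloured_hat S p h * coloured_hat (p @: S) q k.
Proof.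
move=> pS qS; have pqS := preservesM pS qS.
case: (hat_ext) => _ _ he /(_ S p h q k pS qS) hM.
have [pa pe] := he _ _ _ pS; have [qa qe] := he _ _ _ qS.
move: (p * q) (h * k) pqS hM => pq hk pqS hM; apply/permP=> z.
rewrite [LHS](coloured_hatE pqS) [RHS]permM [RHS](coloured_hatE qS).
rewrite [in RHS](coloured_hatE pS).
apply: coloured_eq => [|D].
  rewrite (base_lift (recolour_lifts pqS)) (base_lift (recolour_lifts qS)).
  by rewrite (base_lift (recolour_lifts pS)) hM permM.
rewrite -(perm_imsetVK (hat S pq hk) D); move: (_ @: D) => {}D.
rewrite (colour_lift (recolour_lifts pqS)).
have im : hat S pq hk @: D = hat (p @: S) q k @: (hat S p h @: D).
  by rewrite hM -imset_comp; apply: eq_imset => y; rewrite permM.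
rewrite im (colour_lift (recolour_lifts qS)) (colour_lift (recolour_lifts pS)).
rewrite (base_lift (recolour_lifts pS)) (bad_image _ pa) mem_imset; last exact: perm_inj.
case: ifP => [/andP[bD zD]|_]; last by rewrite hM permM.
have cz : colour z D \in palette D by have := colourP z D; rewrite bD zD.
have imS : psi @: (p @: S) :&: hat S p h @: D = hat S p h @: (psi @: S :&: D).
  rewrite imsetI; last by move=> x y _ _; exact: perm_inj.
  by rewrite -!imset_comp; congr (_ :&: _); apply: eq_in_imset => x xS; rewrite /= pe.
rewrite /recolour imS im; symmetry; apply: ext_comp => //.
- exact: recolour_extendable.
- rewrite -imS; apply: recolour_extendable => //; by rewrite (bad_image _ pa).
- by move=> y _; rewrite hM permM.
Qed.

Lemma coloured_extension :
  coherent_extension phi coloured_ops coloured_base coloured_hat.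
Proof.
split=> [|i x|S p h pS|S p h q k].
- exact: coloured_base_inj.
- exact: coloured_ops_base.
- split; last exact: coloured_hat_base.
  exact: coloured_lift_preserves (recolour_lifts pS).
- exact: coloured_hatM.
Qed.

Lemma compatible_base_inj (C : {set coloured}) :
  {in C &, forall z w, z != w -> compatible z w} -> {in C &, injective base_of}.
Proof.
move=> CC z w zC wC e; apply/eqP; apply: contraT => /(CC _ _ zC wC).
by rewrite /compatible e eqxx.
Qed.

(** Distinct points of [C] would need distinct colours for the bad set onto
    which [C] projects, and there is one colour too few. *)
Lemma compatible_not_bad (C : {set coloured}) :
  {in C &, forall z w, z != w -> compatible z w} -> ~~ bad (base_of @: C).
Proof.
move=> CC; apply/negP=> bD.
have b_inj := compatible_base_inj CC.
set D := base_of @: C.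
have c_inj : {in C &, injective (colour^~ D)}.
  move=> z w zC wC e; apply/eqP; apply: contraT => /(CC _ _ zC wC) /andP[_].
  by move/forallP/(_ D); rewrite bD !imset_f //= e eqxx.
have : (colour^~ D) @: C \subset palette D.
  by apply/subsetP=> _ /imsetP[z zC ->]; have := colourP z D; rewrite bD imset_f.
move/subset_leq_card; rewrite card_in_imset // -(card_in_imset b_inj).
by rewrite -/D (card_palette bD) ltnn.
Qed.

(** The projection of [C] is moved into the image of [psi] by an automorphism
    [g] of [Phi]. It lifts to an automorphism that also recolours: the colour of
    each [z] in [C], which is unique to [z], becomes the one that the image of
    [X] has at [g (base_of z)]. *)
Lemma compatible_faithful (C : {set coloured}) :
  {in C &, forall z w, z != w -> compatible z w} ->
  exists (g : {perm coloured}) (h : {perm V}),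
    preserves coloured_ops setT g h /\ g @: C \subset codom coloured_base.
Proof.
move=> CC; have /badPn[g [h [gP gC]]] := compatible_not_bad CC.
have b_inj := compatible_base_inj CC.
have gbase z : z \in C -> exists x, g (base_of z) = psi x.
  move=> zC; have /subsetP/(_ (g (base_of z))) := gC.
  by rewrite imset_f ?imset_f // => /(_ isT)/codomP.
pose hits D c := [pick z in C | (base_of z \in D) && (colour z D == c)].
pose target D c := if hits D c is Some z then g (base_of z) else c.
pose P D := [set colour z D | z in C & base_of z \in D].
pose r D := ext (palette D) (palette (g @: D)) (P D) (target D).
have targetE D z : bad D -> z \in C -> base_of z \in D ->
    target D (colour z D) = g (base_of z).
  move=> bD zC zD; rewrite /target /hits; case: pickP => [w /and3P[wC wD /eqP e]|/(_ z)].
    congr (g _); congr base_of; apply/eqP; apply: contraT => /(CC _ _ wC zC)/andP[_].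
    by move/forallP/(_ D); rewrite bD wD zD e eqxx.
  by rewrite zC zD eqxx.
have ex D : bad D -> extendable (palette D) (palette (g @: D)) (P D) (target D).
  move=> bD; split.
  - apply/subsetP=> _ /imsetP[z /setIdP[zC zD] ->].
    by have := colourP z D; rewrite bD zD.
  - apply/subsetP=> _ /imsetP[_ /imsetP[z /setIdP[zC zD] ->] ->].
    rewrite targetE //; have [x e] := gbase z zC; rewrite e; apply: palette_base.
    by rewrite -e imset_f.
  - move=> _ _ /imsetP[z /setIdP[zC zD] ->] /imsetP[w /setIdP[wC wD] ->].
    by rewrite !targetE // => /perm_inj/b_inj ->.
  - apply: succn_inj; rewrite -!card_palette // ?(bad_image _ gP) //.
    by rewrite card_imset //; exact: perm_inj.
have gl : lifts g h r.
  split=> // D bD; split=> [c|]; [exact: ext_mem (ex D bD)|exact: ext_inj (ex D bD)].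
exists (to_perm (coloured_lift g r)), h; split; first exact: coloured_lift_preserves.
apply/subsetP=> _ /imsetP[z zC ->]; have [x e] := gbase z zC.
apply/codomP; exists x; rewrite to_permE; last exact: coloured_lift_inj gl.
apply: coloured_eq => [|D]; first by rewrite (base_lift gl).
rewrite -(perm_imsetVK g D); move: (_ @: D) => {}D.
rewrite (colour_lift gl) colour_base; case: ifP => [/andP[bD zD]|_] //.
by rewrite /r ext_in ?targetE //; apply: imset_f; rewrite inE zC.
Qed.

Lemma linked_compatible (C : {set coloured}) :
  linked coloured_ops C -> {in C &, forall z w, z != w -> compatible z w}.
Proof.
move=> CL z w zC wC zw; have [i [x [zx wx]]] := CL z w zC wC zw.
rewrite /coloured_ops; case: ifP => [gen _|]; last by rewrite eqxx.
by move/allP: gen => /(_ _ zx)/allP/(_ _ wx); rewrite (negbTE zw).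
Qed.

End Colours.

Lemma faithful_coherent_extension (n : nat) (a : 'I_n -> nat) (ha : forall i, 0 < a i)
    (V X : finType) (phi : operations a V X) :
  exists (Z : finType) (Phi : operations a V Z) (psi : X -> Z)
         (hat : {set X} -> {perm X} -> {perm V} -> {perm Z}),
    coherent_extension phi Phi psi hat /\
    forall C : {set Z}, linked Phi C ->
      exists (g : {perm Z}) (h : {perm V}),
        preserves Phi setT g h /\ g @: C \subset codom psi.
Proof.
do 4! eexists; split; first exact: coloured_extension (valued_extension ha phi).
by move=> C /linked_compatible/compatible_faithful.
Qed.

(** * Two-sorted structures from operations *)

Section TwoSorted.
Variables (n : nat) (a : 'I_n -> nat).
Variables (Z V : finType) (Phi : operations a V Z).
Arguments Phi : clear implicits.

Definition is_left (w : Z + V) := if w is inl _ then true else false.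

Definition two_sorted_fun i (t : (a i).-tuple (Z + V)) : {set Z + V} :=
  \bigcup_(z : (a i).-tuple Z | t == map_tuple inl z) inr @: Phi i z.

Definition two_sorted : structure (UV_language a) :=
  @Structure (UV_language a) (Z + V)%type
    (fun R => [set t | is_left (thead t) == R])
    (fun i => [ffun t => @two_sorted_fun i t]).

Lemma two_sorted_relE R (t : 1.-tuple two_sorted) :
  (t \in @rel_of _ two_sorted R) = (is_left (thead t) == R).
Proof. by rewrite inE. Qed.

Lemma inl_map_inj m : injective (@map_tuple m Z (Z + V) inl).
Proof.
move=> x y /(congr1 val) /= e; apply: val_inj; apply: (inj_map _ e).
by move=> ? ? [].
Qed.

Lemma two_sorted_funE i (z : (a i).-tuple Z) :
  @fun_of _ two_sorted i (map_tuple inl z) = inr @: Phi i z.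
Proof.
rewrite ffunE /two_sorted_fun (big_pred1 z) // => y.
by rewrite /= (inj_eq (@inl_map_inj _)) eq_sym.
Qed.

Lemma two_sorted_fun0 i (t : (a i).-tuple (Z + V)) v :
  inr v \in t -> @fun_of _ two_sorted i t = set0.
Proof.
move=> vt; rewrite ffunE; apply: big1 => z /eqP e; move: vt.
by rewrite e => /mapP[].
Qed.

Lemma all_left m (t : m.-tuple (Z + V)) :
  (exists z, t = map_tuple inl z) \/ exists v, inr v \in t.
Proof.
have [/hasP[[//|v] vt _]|/hasPn H] := boolP (has (predC is_left) t).
  by right; exists v.
left; have ex j : exists z, tnth t j == inl z.
  by have := H _ (mem_tnth j t); case: (tnth t j) => // z _; exists z.
exists [tuple xchoose (ex j) | j < m]; apply: eq_from_tnth => j.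
by rewrite tnth_map tnth_mktuple; apply/eqP/(xchooseP (ex j)).
Qed.

Lemma two_sorted_class : UV_class two_sorted.
Proof.
split; first by apply/setP=> -[z|v]; rewrite !inE.
  by apply/setP=> -[z|v]; rewrite !inE.
move=> i; split=> t; have [[z ->]|[v vt]] := all_left t.
- by move=> _ j; rewrite tnth_map !inE.
- by rewrite inE (two_sorted_fun0 vt) eqxx.
- by rewrite two_sorted_funE; apply/subsetP=> _ /imsetP[v _ ->]; rewrite !inE.
- by rewrite (two_sorted_fun0 vt) sub0set.
Qed.

Definition sum_map (g : Z -> Z) (h : V -> V) (w : two_sorted) : two_sorted :=
  match w with inl z => inl (g z) | inr v => inr (h v) end.

Lemma sum_map_automorphism (g : {perm Z}) (h : {perm V}) :
  preserves Phi setT g h -> is_automorphism (sum_map g h).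
Proof.
move=> /preservesP gP; have gh_inj : injective (sum_map g h).
  by move=> [z|v] [z'|v'] // [] /perm_inj ->.
split; last exact: injF_bij.
split=> // [R t|i t].
  by rewrite !inE; case/tupleP: t => -[z|v] t.
have [[z ->]|[v vt]] := all_left t.
  rewrite two_sorted_funE.
  have -> : map_tuple (sum_map g h) (map_tuple inl z) = map_tuple inl (map_tuple g z).
    by apply: val_inj; rewrite /= -!map_comp.
  rewrite two_sorted_funE gP -?imset_comp //.
  by apply/allP=> w; rewrite inE.
rewrite (two_sorted_fun0 vt) imset0 (@two_sorted_fun0 _ _ (h v)) //.
by apply/mapP; exists (inr v).
Qed.

Lemma removing_closed (D : substructure two_sorted) (X : {set Z}) :
  fun_closed [set d : D | if val d is inl z then z \notin X else true].
Proof.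
apply/forallP=> i; apply/forallP=> t; apply/implyP=> _; apply/subsetP=> d.
rewrite ffunE !inE; have [[z e]|[v vt]] := all_left (map_tuple val t).
  by rewrite e two_sorted_funE => /imsetP[v _ ->].
by rewrite (two_sorted_fun0 vt) inE.
Qed.

Definition removing (D : substructure two_sorted) (X : {set Z}) : substructure D :=
  Substructure (removing_closed D X).

Lemma removingE (D : substructure two_sorted) X (d : D) :
  (d \in sub_set (removing D X)) = (if val d is inl z then z \notin X else true).
Proof. by rewrite inE. Qed.

Lemma removing_proper (D : substructure two_sorted) z : inl z \in sub_set D ->
  sub_set (removing D [set z]) \proper [set: D].
Proof.
move=> zD; rewrite properT; apply/eqP=> /setP/(_ (Sub (inl z) zD)).
by rewrite removingE in_setT /= set11.
Qed.

(** Vertices of the first sort are not values, so removing some of them leaves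
    a substructure. If no tuple with a nonempty value contains both [z] and [w],
    the structure is the free amalgamation of what remains after removing [z]
    and after removing [w]. *)
Lemma irreducible_linked (D : substructure two_sorted) :
  irreducible D -> linked Phi [set z | inl z \in sub_set D].
Proof.
move=> irrD z w; rewrite !inE => zD wD zw.
suff /existsP[i /existsP[x /and3P[? ? ?]]] : [exists i, exists x : (a i).-tuple Z,
    [&& z \in x, w \in x & Phi i x != set0]] by exists i, x.
apply: contraT => /existsPn none; case: irrD.
exists (removing D [set z]), (removing D [set w]), (removing D [set z; w]).
split; try exact: removing_proper.
have out1 (d : D) :
    d \in sub_set (removing D [set z]) :\: sub_set (removing D [set z; w]) ->
    val d = inl w.
  rewrite in_setD !removingE; case: (val d) => [u|//]; rewrite in_set2 in_set1 negbK.
  by case: eqP => //= _; rewrite andbT => /eqP ->.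
have out2 (d : D) :
    d \in sub_set (removing D [set w]) :\: sub_set (removing D [set z; w]) ->
    val d = inl z.
  rewrite in_setD !removingE; case: (val d) => [u|//]; rewrite in_set2 in_set1 negbK.
  by case: (u =P z) => [->|_] //; case: (u =P w).
split.
- apply/setP=> d; rewrite in_setU !removingE in_setT; case: (val d) => [u|//].
  by rewrite !in_set1; case: eqP => // ->; rewrite zw.
- apply/setP=> d; rewrite in_setI !removingE; case: (val d) => [u|//].
  by rewrite !in_set1 in_set2 negb_or.
- move=> R t /hasP[d dt /out1 d1] /hasP[d' d't /out2 d2]; exfalso.
  move: dt d't; rewrite (tuple1_eta t) !inE => /eqP e /eqP e'.
  by move: d1; rewrite e -e' d2 => -[] /eqP; rewrite (negbTE zw).
move=> i t /hasP[d dt /out1 d1] /hasP[d' d't /out2 d2].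
apply/setP=> c; rewrite ffunE !inE; have [[x e]|[v vt]] := all_left (map_tuple val t).
  rewrite e two_sorted_funE; have : Phi i x == set0.
    have /existsPn/(_ x) := none i; rewrite !negb_and negbK.
    have inx u : inl u \in map_tuple val t -> u \in x.
      by rewrite e => /mapP[u' ? [->]].
    by rewrite !inx // -?d1 -?d2; apply: map_f.
  by move/eqP->; rewrite imset0 inE.
by rewrite (two_sorted_fun0 vt) inE.
Qed.

End TwoSorted.

(** * The witness *)

Section Witness.
Variables (n : nat) (a : 'I_n -> nat).
Variables (A : structure (UV_language a)) (CA : UV_class A).

Local Notation U := {u : A | u \in U_of A}.
Local Notation V := {v : A | v \notin U_of A}.

Definition structure_ops : operations a V U := fun i x =>
  [set v | val v \in @fun_of _ A i (map_tuple val x)].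

Lemma vertexP (w : A) : (exists x : U, w = val x) \/ (exists v : V, w = val v).
Proof.
by case: (boolP (w \in U_of A)) => wU; [left; exists (Sub w wU)|right; exists (Sub w wU)].
Qed.

Lemma V_ofE : V_of A = ~: U_of A.
Proof.
case: CA => dis cov _; apply/setP=> w; rewrite in_setC.
have := in_setT w; rewrite -cov in_setU.
have : w \notin U_of A :&: V_of A by rewrite dis in_set0.
by rewrite !in_setI; case: (w \in U_of A); case: (w \in V_of A).
Qed.

Lemma fun_of_V i t w : w \in @fun_of _ A i t -> w \notin U_of A.
Proof.
case: CA => _ _ /(_ i)[_ /(_ t)/subsetP F] /F.
by rewrite V_ofE in_setC.
Qed.

Lemma fun_of_notU i (t : (a i).-tuple A) w :
  w \in t -> w \notin U_of A -> @fun_of _ A i t = set0.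
Proof.
case: CA => _ _ /(_ i)[F _] /tnthP[j ->] wU; apply/eqP; apply: contraNT wU => ne.
by apply: F; rewrite inE.
Qed.

Lemma all_U m (t : m.-tuple A) :
  (exists x : m.-tuple U, t = map_tuple val x) \/ exists2 w, w \in t & w \notin U_of A.
Proof.
have [/hasP[w wt wU]|/hasPn H] := boolP (has (fun w => w \notin U_of A) t).
  by right; exists w.
have tU j : tnth t j \in U_of A by have := H _ (mem_tnth j t); rewrite negbK.
left; exists [tuple (Sub (tnth t j) (tU j) : U) | j < m]; apply: eq_from_tnth => j.
by rewrite tnth_map tnth_mktuple.
Qed.

Variables (Z : finType) (Phi : operations a V Z) (psi : U -> Z).
Variable hat : {set U} -> {perm U} -> {perm V} -> {perm Z}.
Hypothesis hat_ext : coherent_extension structure_ops Phi psi hat.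
Local Notation B := (two_sorted Phi).

Definition vertex_map (w : A) : B :=
  match decP (@idP (w \in U_of A)) with
  | left wU => inl (psi (Sub w wU))
  | right wU => inr (Sub w (introN idP wU))
  end.

Lemma vertex_mapU (x : U) : vertex_map (val x) = inl (psi x).
Proof.
rewrite /vertex_map; case: decP => wU; last by case: (wU (valP x)).
by congr (inl (psi _)); apply: val_inj.
Qed.

Lemma vertex_mapV (v : V) : vertex_map (val v) = inr v.
Proof.
rewrite /vertex_map; case: decP => wU; first by case: (negP (valP v) wU).
by congr inr; apply: val_inj.
Qed.

Lemma vertex_map_inj : injective vertex_map.
Proof.
case: hat_ext => psi_inj _ _ _ w w'.
case: (vertexP w) => -[x ->]; case: (vertexP w') => -[x' ->];
  rewrite ?vertex_mapU ?vertex_mapV // => -[].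
  by move/psi_inj->.
by move->.
Qed.

Lemma is_left_vertex_map w : is_left (vertex_map w) = (w \in U_of A).
Proof.
case: (vertexP w) => -[x ->]; rewrite ?vertex_mapU ?vertex_mapV /=.
  by rewrite (valP x).
by rewrite (negbTE (valP x)).
Qed.

Lemma vertex_map_embedding : is_embedding vertex_map.
Proof.
case: hat_ext => psi_inj PhiE _ _; split=> [|R t|i t]; first exact: vertex_map_inj.
  rewrite two_sorted_relE /thead tnth_map is_left_vertex_map -/(thead t).
  rewrite {1}(tuple1_eta t); move: (thead t) => w.
  have wV : (w \in V_of A) = (w \notin U_of A) by rewrite V_ofE in_setC.
  case: R {t} => /=; first by rewrite eqb_id inE.
  by rewrite eqbF_neg -wV inE.
have [[x ->]|[w wt wU]] := all_U t; last first.
  rewrite (fun_of_notU wt wU) imset0.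
  rewrite (@two_sorted_fun0 _ _ _ _ _ _ _ (Sub w wU)) //.
  by apply/mapP; exists w => //; rewrite -vertex_mapV.
have -> : map_tuple vertex_map (map_tuple val x) = map_tuple inl (map_tuple psi x).
  by apply: val_inj; rewrite /= -!map_comp; apply: eq_map => y /=; rewrite vertex_mapU.
rewrite two_sorted_funE PhiE; apply/setP=> b; apply/imsetP/imsetP=> -[w wF ->].
  have wU := fun_of_V wF; exists (Sub w wU); first by rewrite inE.
  by rewrite -vertex_mapV.
by rewrite inE in wF; exists (val w) => //; rewrite vertex_mapV.
Qed.

Definition witness_embedding : embedding A B := Embedding vertex_map_embedding.
Local Notation P := (emb_image witness_embedding).

Section PartialAutomorphism.
Variables (D : {set A}) (f : A -> A).

Definition trace_U : {set U} := [set x | val x \in D].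
Definition trace_V : {set V} := [set v | val v \in D].
Definition map_U (x : U) : U := insubd x (f (val x)).
Definition map_V (v : V) : V := insubd v (f (val v)).
Definition perm_U : {perm U} := ext_perm trace_U map_U.
Definition perm_V : {perm V} := ext_perm trace_V map_V.

Definition extension : B -> B := sum_map (hat trace_U perm_U perm_V) perm_V.

(** By the closure condition in the third clause, the values on tuples of [D]
    lie in [D], where [perm_V] is determined by [f]. *)
Definition partial_auto : Prop :=
  [/\ {in D &, injective f},
      {in D, forall w, (f w \in U_of A) = (w \in U_of A)}
    & forall i (t : (a i).-tuple A), all (mem D) t ->
        @fun_of _ A i t \subset D /\
        @fun_of _ A i (map_tuple f t) = f @: @fun_of _ A i t].

Hypothesis fP : partial_auto.

Lemma val_map_U x : x \in trace_U -> val (map_U x) = f (val x).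
Proof.
rewrite inE => xD; apply: insubdK; case: fP => _ fU _.
by rewrite -[_ \in _]/(f (val x) \in U_of A) fU // (valP x).
Qed.

Lemma val_map_V v : v \in trace_V -> val (map_V v) = f (val v).
Proof.
rewrite inE => vD; apply: insubdK; case: fP => _ fU _.
by rewrite -[_ \in _]/(f (val v) \notin U_of A) fU // (valP v).
Qed.

Lemma map_U_inj : {in trace_U &, injective map_U}.
Proof.
case: fP => f_inj _ _ x y xD yD /(congr1 val); rewrite !val_map_U // => e.
by apply: val_inj; apply: f_inj => //; [move: xD|move: yD]; rewrite inE.
Qed.

Lemma map_V_inj : {in trace_V &, injective map_V}.
Proof.
case: fP => f_inj _ _ x y xD yD /(congr1 val); rewrite !val_map_V // => e.
by apply: val_inj; apply: f_inj => //; [move: xD|move: yD]; rewrite inE.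
Qed.

Lemma val_perm_U x : x \in trace_U -> val (perm_U x) = f (val x).
Proof. by move=> xD; rewrite ext_perm_in ?val_map_U //; exact: map_U_inj. Qed.

Lemma val_perm_V v : v \in trace_V -> val (perm_V v) = f (val v).
Proof. by move=> vD; rewrite ext_perm_in ?val_map_V //; exact: map_V_inj. Qed.

Lemma partial_auto_preserves : preserves structure_ops trace_U perm_U perm_V.
Proof.
apply/preservesP=> i x /allP xD; case: fP => f_inj _ /(_ i (map_tuple val x)).
case=> [|FD Ff]; first by apply/allP=> _ /mapP[y /xD yD ->]; move: yD; rewrite /= inE.
have e : map_tuple val (map_tuple perm_U x) = map_tuple f (map_tuple val x).
  apply: val_inj; rewrite /= -!map_comp; apply/eq_in_map => y /xD yD /=.
  exact: val_perm_U.
apply/setP=> w; rewrite inE e Ff; apply/imsetP/imsetP=> [[v vF ev]|[v vF ->]].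
  exists (Sub v (fun_of_V vF)); first by rewrite inE.
  by apply: val_inj; rewrite val_perm_V //= inE (subsetP FD).
rewrite inE in vF; exists (val v) => //; rewrite val_perm_V //.
by rewrite inE (subsetP FD).
Qed.

Lemma extension_automorphism : is_automorphism extension.
Proof.
apply: sum_map_automorphism.
by case: hat_ext => _ _ /(_ _ _ _ partial_auto_preserves)[].
Qed.

Lemma extension_extends w : w \in D -> extension (vertex_map w) = vertex_map (f w).
Proof.
case: hat_ext => _ _ /(_ _ _ _ partial_auto_preserves)[_ he] _.
case: (vertexP w) => -[x ->] xD.
  rewrite vertex_mapU /= he ?inE // -vertex_mapU val_perm_U //.
  by rewrite inE.
by rewrite vertex_mapV /= -vertex_mapV val_perm_V // inE.
Qed.

Lemma trace_U_image : perm_U @: trace_U = [set x | val x \in f @: D].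
Proof.
apply/setP=> y; rewrite inE; apply/imsetP/imsetP=> [[x xD ->]|[w wD e]].
  by exists (val x); [move: xD; rewrite inE|rewrite val_perm_U].
case: fP => _ fU _; have wU : w \in U_of A by rewrite -fU // -e (valP y).
have wt : (Sub w wU : U) \in trace_U by rewrite inE.
by exists (Sub w wU) => //; apply: val_inj; rewrite val_perm_U.
Qed.

End PartialAutomorphism.

Lemma trace_V_image (D : {set A}) f : partial_auto D f ->
  map_V f @: trace_V D = trace_V (f @: D).
Proof.
move=> fP; apply/setP=> y; rewrite inE; apply/imsetP/imsetP=> [[x xD ->]|[w wD e]].
  by exists (val x); [move: xD; rewrite inE|rewrite (val_map_V fP)].
case: (fP) => _ fU _; have wU : w \notin U_of A by rewrite -fU // -e (valP y).
have wt : (Sub w wU : V) \in trace_V D by rewrite inE.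
by exists (Sub w wU) => //; apply: val_inj; rewrite (val_map_V fP).
Qed.

Lemma extension_comp (D : {set A}) f g k : partial_auto D f ->
  partial_auto (f @: D) g -> {in D, forall w, k w = g (f w)} ->
  extension D k =1 extension (f @: D) g \o extension D f.
Proof.
move=> fP gP kgf.
have tU : trace_U (f @: D) = perm_U D f @: trace_U D by rewrite (trace_U_image fP).
have tU' : trace_U (f @: D) = map_U f @: trace_U D.
  rewrite tU; apply: eq_in_imset => x xD; apply: val_inj.
  by rewrite (val_perm_U fP) // (val_map_U fP).
have tV := trace_V_image fP.
have pU : (perm_U D f * perm_U (f @: D) g)%g = perm_U D k.
  rewrite {2}/perm_U tU'; apply: ext_perm_comp; first exact: map_U_inj.
    by rewrite -tU'; exact: map_U_inj.
  move=> x xD; apply: val_inj.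
  rewrite (val_map_U gP) ?tU' ?imset_f // (val_map_U fP) //.
  have xD' : val x \in D by rewrite inE in xD.
  rewrite insubdK kgf // -[_ \in _]/(g (f (val x)) \in U_of A).
  case: gP fP => _ gU _ [_ fU _].
  by rewrite gU ?imset_f // fU // (valP x).
have pV : (perm_V D f * perm_V (f @: D) g)%g = perm_V D k.
  rewrite {2}/perm_V -tV; apply: ext_perm_comp; first exact: map_V_inj.
    by rewrite tV; exact: map_V_inj.
  move=> x xD; apply: val_inj.
  rewrite (val_map_V gP) -?tV ?imset_f // (val_map_V fP) //.
  have xD' : val x \in D by rewrite inE in xD.
  rewrite insubdK kgf // -[_ \in _]/(g (f (val x)) \notin U_of A).
  case: gP fP => _ gU _ [_ fU _].
  by rewrite gU ?imset_f // fU // (valP x).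
have fS := partial_auto_preserves fP.
have gS := partial_auto_preserves gP; rewrite tU in gS.
case: hat_ext => _ _ _ /(_ _ _ _ _ _ fS gS) hM.
rewrite pU pV in hM.
rewrite /extension tU => -[z|v] /=.
  by rewrite hM; congr inl; exact: permM.
by rewrite -pV; congr inr; exact: permM.
Qed.

(** From maps between substructures of the image of [A] to maps of [A]. *)
Section Pull.
Variables (D E : substructure P).

Definition inc (D : substructure P) (d : D) : B := sub_val (sub_val d).

Lemma inc_embedding (D' : substructure P) : is_embedding (@inc D').
Proof.
have [i1 r1 f1] := sub_val_embedding D'.
have [i2 r2 f2] := sub_val_embedding (emb_image witness_embedding).
have mc m (x : m.-tuple D') :
    map_tuple (@inc D') x = map_tuple (@sub_val _ _ P) (map_tuple (@sub_val _ _ D') x).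
  by rewrite map_tuple_comp.
split=> [x y /i2/i1 //|R x|F x].
  by rewrite mc; exact: iff_trans (r1 R x) (r2 R _).
by rewrite mc -f2 -f1 -imset_comp.
Qed.

Definition pull_set (D : substructure P) : {set A} :=
  [set w | [exists d : D, vertex_map w == inc d]].

Lemma inc_vertex (D' : substructure P) (d : D') :
  exists2 w, w \in pull_set D' & inc d = vertex_map w.
Proof.
have /imsetP[w _ e] := svalP (sub_val d).
by exists w => //; rewrite inE; apply/existsP; exists d; apply/eqP/esym.
Qed.

Variable f : {ffun D -> E}.

Definition pull_map (w : A) : A :=
  odflt w [pick w' | [exists d : D,
    (vertex_map w == inc d) && (vertex_map w' == inc (f d))]].

Lemma pull_mapE d w : vertex_map w = inc d -> vertex_map (pull_map w) = inc (f d).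
Proof.
move=> wd; rewrite /pull_map; case: pickP => [w' /existsP[d' /andP[/eqP wd' /eqP e]]|no].
  rewrite e; congr (inc (f _)); case: (inc_embedding D) => inj _ _; apply: inj.
  by rewrite -wd -wd'.
have [w' _ e] := inc_vertex (f d); have /existsP[] := no w'.
by exists d; rewrite wd e !eqxx.
Qed.

Hypothesis fP : is_isomorphism f.

Lemma pull_tuple i (t : (a i).-tuple A) : all (mem (pull_set D)) t ->
  exists d, map_tuple vertex_map t = map_tuple (@inc D) d.
Proof.
move=> /allP tD; have ex j : exists d : D, vertex_map (tnth t j) == inc d.
  have tj : tnth t j \in pull_set D := tD _ (mem_tnth j t).
  by move: tj; rewrite inE => /existsP.
exists [tuple xchoose (ex j) | j < a i]; apply: eq_from_tnth => j.
by rewrite tnth_map [RHS]tnth_map tnth_mktuple; apply/eqP/(xchooseP (ex j)).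
Qed.

Lemma pull_image : pull_map @: pull_set D = pull_set E.
Proof.
case: fP => _ [f' fK f'K]; apply/setP=> w; apply/imsetP/idP=> [[u]|].
  rewrite !inE => /existsP[d /eqP ud] ->; apply/existsP; exists (f d).
  by rewrite (pull_mapE ud).
rewrite inE => /existsP[d /eqP wd]; have [u uD ue] := inc_vertex (f' d).
exists u => //; apply: vertex_map_inj; rewrite (pull_mapE (esym ue)) wd.
by rewrite f'K.
Qed.

Lemma pull_partial_auto : partial_auto (pull_set D) pull_map.
Proof.
case: fP => -[f_inj fR fF] _.
have [Di DR DF] := inc_embedding D; have [Ei ER EF] := inc_embedding E.
have [_ vR vF] := vertex_map_embedding.
split=> [w w'|w|i t tD].
- rewrite !inE => /existsP[d /eqP wd] /existsP[d' /eqP wd'] /(congr1 vertex_map).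
  rewrite (pull_mapE wd) (pull_mapE wd') => /Ei/f_inj e.
  by apply: vertex_map_inj; rewrite wd wd' e.
- rewrite inE => /existsP[d /eqP wd].
  rewrite -!is_left_vertex_map (pull_mapE wd) wd.
  have lE (D' : substructure P) (d' : D') :
      is_left (inc d') = ([tuple d'] \in @rel_of _ D' true).
    have [_ R' _] := inc_embedding D'.
    have := R' true [tuple d']; rewrite two_sorted_relE eqb_id => R''.
    by apply/idP/idP=> /R''.
  have := fR true [tuple d].
  have -> : map_tuple f [tuple d] = [tuple f d] by exact: val_inj.
  by rewrite !lE => fR'; apply/idP/idP=> /fR'.
have [d td] := pull_tuple tD.
have tF := vF i t; rewrite td -(DF i) in tF.
have key w : w \in @fun_of _ A i t -> exists2 c, c \in @fun_of _ D i d & vertex_map w = inc c.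
  by move=> wF; apply/imsetP; rewrite -tF imset_f.
split.
  apply/subsetP=> w /key[c _ wc]; rewrite inE; apply/existsP; exists c.
  exact/eqP.
apply: (imset_inj vertex_map_inj).
rewrite (vF i).
have -> : map_tuple vertex_map (map_tuple pull_map t) = map_tuple (@inc E) (map_tuple f d).
  apply: eq_from_tnth => j; rewrite !tnth_map; apply: pull_mapE.
  by have := congr1 (fun s => tnth s j) td; rewrite !tnth_map.
rewrite -(EF i) -(fF i).
apply/setP=> b; apply/imsetP/imsetP=> [[e /imsetP[c cF ->] ->]|[u /imsetP[w wF ->] ->]].
  have /imsetP[w wF ew] : inc c \in vertex_map @: @fun_of _ A i t by rewrite tF imset_f.
  by exists (pull_map w); rewrite ?imset_f // (pull_mapE (esym ew)).
have [c cF wc] := key w wF.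
by exists (f c); rewrite ?imset_f // (pull_mapE wc).
Qed.

End Pull.

Lemma pull_map_comp (D E G : substructure P) (f : {ffun D -> E}) (g : {ffun E -> G}) :
  {in pull_set D, forall w,
     pull_map [ffun d => g (f d)] w = pull_map g (pull_map f w)}.
Proof.
move=> w; rewrite inE => /existsP[d /eqP wd]; apply: vertex_map_inj.
by rewrite (pull_mapE _ wd) (pull_mapE _ (pull_mapE f wd)) ffunE.
Qed.

Lemma witness_coherent : coherent_EPPA_via witness_embedding.
Proof.
exists (fun D E f => extension (pull_set D) (pull_map f)); split.
  move=> D E f fP; have pP := pull_partial_auto fP; split.
    exact: extension_automorphism.
  move=> d; rewrite -/(inc d) -/(inc (f d)); have [w wD e] := inc_vertex d.
  by rewrite e (extension_extends pP) // (pull_mapE f (esym e)).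
move=> D E G f g fP gP.
have fA := pull_partial_auto fP; have gA := pull_partial_auto gP.
rewrite -(pull_image fP) in gA *.
by apply: extension_comp => //; exact: pull_map_comp.
Qed.

End Witness.

Theorem theorem12p7 (n : nat) (a : 'I_n -> nat) (ha : forall i : 'I_n, 0 < a i) :
  has_isf_coherent_EPPA (@UV_class n a).
Proof.
move=> A CA.
have [Z [Phi [psi [hat [ext faithful]]]]] :=
  faithful_coherent_extension ha (@structure_ops n a A).
exists (two_sorted Phi); first exact: two_sorted_class.
exists (witness_embedding CA ext); first exact: witness_coherent.
move=> D /irreducible_linked/faithful[g [h [gP gD]]].
exists (sum_map g h); first exact: sum_map_automorphism.
apply/subsetP=> _ /imsetP[[z|v] zD ->] /=.
  have : g z \in codom psi by apply: (subsetP gD); rewrite imset_f // inE.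
  case/codomP=> x ->; apply/imsetP; exists (val x) => //.
  by rewrite /= vertex_mapU.
by apply/imsetP; exists (val (h v)); rewrite //= vertex_mapV.
Qed.
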